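(* Let $M$ be a bounded lattice and let $\theta$ be a lattice congruence of $M$ such that $0/\theta=\{0\}$ and $1/\theta=\{1\}$; let $m$ be a nonzero cardinality. Assume that $e=\max(e/\theta)$ for all $e\in\mathcal B(M)$ (in particular, this hypothesis may be replaced by any one of: $(e]_M\in\mathcal Ann(M)$ for all $e\in\mathcal B(M)$; $M$ is uniquely complemented; $\mathcal B(M)$ is a Boolean sublattice of $M$). For $s$ being either a cardinality $\kappa$, or the symbol $<\infty$, or the symbol $\mathrm{all}$, call a set $s$-small if, respectively, it has cardinality at most $\kappa$, it is finite, or it is arbitrary, and consider the following conditions: $(1)_s$: for every $s$-small $U\subseteq M$ there is $e\in\mathcal B(M)$ with $\mathrm{Ann}_M(U)=(e]_M$; $(2)_s$: $M$ is a Stone lattice and $\mathcal B(M)$ is an $s$-complete Boolean sublattice of $M$; $(3)_s$: $\mathrm{P2Ann}(M)$ is an $s$-complete Boolean sublattice of $\mathrm{Id}(M)$ such that $a\mapsto \mathrm{Ann}_M(\mathrm{Ann}_M(a))$ is a lattice morphism from $M$ to $\mathrm{P2Ann}(M)$; $(4)_s$: $\mathrm{Ann}_M(a\wedge b)=(\mathrm{Ann}_M(a)\cup\mathrm{Ann}_M(b)]_M$ for all $a,b\in M$, and $\mathrm{Ann}_M(\mathrm{Ann}_M(U))\in\mathrm{PAnn}(M)$ for every $s$-small $U\subseteq M$; $(5)_s$: $(\mathrm{Ann}_M(U)\cup\mathrm{Ann}_M(\mathrm{Ann}_M(U))]_M=M$ for every $s$-small $U\subseteq M$; $(iv)$: $\mathrm{Ann}_M(a\wedge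 b)=(\mathrm{Ann}_M(a)\cup\mathrm{Ann}_M(b)]_M$ for all $a,b\in M$. Then: (i) if $M/\theta$ is distributive, then for any nonzero cardinality $\kappa$ the conditions $(1)_\kappa,(2)_\kappa,(3)_\kappa,(4)_\kappa,(5)_\kappa$ are equivalent; (ii) if $M/\theta$ is distributive and $\mathcal Ann_m(M)=\mathrm{PAnn}(M)$ (the latter holding in particular if $M/\theta$ is closed with respect to the joins of all families of elements of cardinality at most $m$ and has the meet distributive with respect to such joins), then for any $h,i\in\{1,\dots,5\}$ and any nonzero cardinality $\kappa\le m$ the conditions $(h)_\kappa$ and $(i)_{<\infty}$ are equivalent; (iii) if $M/\theta$ is distributive and $\mathcal Ann(M)=\mathrm{PAnn}(M)$ (in particular if $M/\theta$ is a frame), then for any $h,i,j\in\{1,\dots,5\}$ and any nonzero cardinality $\kappa$ the conditions $(iv)$, $(h)_\kappa$, $(i)_{<\infty}$ and $(j)_{\mathrm{all}}$ are equivalent.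
   Context: For a bounded lattice $M$ (not necessarily distributive): $\mathcal B(M)$ is the set of complemented elements of $M$. For $U\subseteq M$, $(U]_M$ is the ideal generated by $U$, $(a]_M=(\{a\}]_M$, and $\mathrm{Id}(M)$ is the lattice of ideals. $\mathrm{Ann}_M(a)=\{x\in M: x\wedge a=0\}$ and $\mathrm{Ann}_M(U)=\bigcap_{u\in U}\mathrm{Ann}_M(u)$ (so $\mathrm{Ann}_M(\emptyset)=M$); these need not be ideals in general. $\mathcal Ann(M)=\{\mathrm{Ann}_M(U): U\subseteq M\}$, $\mathcal Ann_m(M)=\{\mathrm{Ann}_M(U): U\subseteq M, |U|\le m\}$, $\mathrm{PAnn}(M)=\{\mathrm{Ann}_M(a): a\in M\}$, $\mathrm{P2Ann}(M)=\{\mathrm{Ann}_M(\mathrm{Ann}_M(a)): a\in M\}$. $M$ is Stone if for all $a\in M$ there is $e\in\mathcal B(M)$ with $\mathrm{Ann}_M(a)=(e]_M$. ''Uniquely complemented'' means that every element of $\mathcal B(M)$ has exactly one complement in $M$. A Boolean sublattice is a bounded sublattice which is a Boolean algebra; it is $s$-complete if each of its $s$-small subsets has a supremum and an infimum computed in that Boolean algebra itself. A frame is a complete lattice in which $x\wedge\bigvee_i y_i=\bigvee_i(x\wedge y_i)$ for arbitrary families. For a congruence $\theta$ and $x\in M$, $x/\theta$ is the class of $x$. *)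

(* Defs.v *)
From HB Require Import structures.
From mathcomp Require Import all_boot all_order generic_quotient.
From mathcomp Require Import mathcomp_extra boolp classical_sets functions.
From mathcomp Require Import cardinality.

Set Implicit Arguments.
Unset Strict Implicit.
Unset Printing Implicit Defensive.

Import Order.TTheory.

Local Open Scope quotient_scope.
Local Open Scope classical_set_scope.
Local Open Scope card_scope.
Local Open Scope order_scope.

(* A cardinality is represented by a type K having that cardinality, so that
   "at most K elements" means "injects into K". *)
Variant size_bound : Type :=
  | AtMost (K : Type)
  | FinitelyMany
  | AnyNumber.

Definition small (s : size_bound) (T : Type) (U : set T) : Prop :=
  match s with
  | AtMost K => U #<= [set: K]
  | FinitelyMany => finite_set U
  | AnyNumber => True
  end.

Section Lattices.
Context {d : Order.disp_t}.

Definition greatest (L : porderType d) (A : set L) (x : L) : Prop :=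
  A x /\ ubound A x.

Definition distributive_lattice (L : latticeType d) : Prop :=
  forall x y z : L, x `&` (y `|` z) = (x `&` y) `|` (x `&` z).

Definition has_small_joins (s : size_bound) (L : latticeType d) : Prop :=
  forall V : set L, small s V -> exists v, supremums V v.

Definition meet_distributes_small_joins (s : size_bound) (L : latticeType d) :
    Prop :=
  forall (V : set L) (v x : L), small s V -> supremums V v ->
    supremums [set x `&` y | y in V] (x `&` v).

Definition complete_lattice (L : latticeType d) : Prop :=
  forall V : set L, (exists v, supremums V v) /\ (exists v, infimums V v).

Definition frame (L : latticeType d) : Prop :=
  complete_lattice L /\ meet_distributes_small_joins AnyNumber L.

Definition is_complement (L : tbLatticeType d) (x y : L) : Prop :=
  x `&` y = \bot /\ x `|` y = \top.

Definition complemented (L : tbLatticeType d) : set L :=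
  [set x | exists y, is_complement x y].

Definition uniquely_complemented (L : tbLatticeType d) : Prop :=
  forall e : L, complemented e -> exists! f, is_complement e f.

Definition bounded_sublattice (L : tbLatticeType d) (S : set L) : Prop :=
  [/\ S \bot, S \top,
      forall x y, S x -> S y -> S (x `&` y) &
      forall x y, S x -> S y -> S (x `|` y)].

Definition boolean_sublattice (L : tbLatticeType d) (S : set L) : Prop :=
  [/\ bounded_sublattice S,
      forall x y z, S x -> S y -> S z ->
        x `&` (y `|` z) = (x `&` y) `|` (x `&` z) &
      forall x, S x -> exists2 y, S y & is_complement x y].

(* Suprema and infima are those of the poset S, not those of L. *)
Definition supremum_in (L : porderType d) (S V : set L) (v : L) : Prop :=
  [/\ S v, ubound V v & forall w, S w -> ubound V w -> v <= w].

Definition infimum_in (L : porderType d) (S V : set L) (v : L) : Prop :=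
  [/\ S v, lbound V v & forall w, S w -> lbound V w -> w <= v].

Definition complete_boolean_sublattice (s : size_bound) (L : tbLatticeType d)
    (S : set L) : Prop :=
  boolean_sublattice S /\
  forall V : set L, (V `<=` S)%classic -> small s V ->
    (exists v, supremum_in S V v) /\ (exists v, infimum_in S V v).

Definition is_ideal (L : latticeType d) (I : set L) : Prop :=
  [/\ I !=set0,
      forall x y, x <= y -> I y -> I x &
      forall x y, I x -> I y -> I (x `|` y)].

Definition ideal_gen (L : latticeType d) (U : set L) : set L :=
  smallest (@is_ideal L) U.

Definition principal_ideal (L : latticeType d) (a : L) : set L :=
  ideal_gen [set a].

End Lattices.

Arguments complemented {d} L _.
Arguments is_ideal {d} L _.

Section IdealLattice.
Context {d : Order.disp_t} (M : tbLatticeType d).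

Record ideal : Type := Ideal {
  ideal_set :> set M;
  ideal_setP : is_ideal M ideal_set }.

Lemma ideal_ext (I J : ideal) : ideal_set I = ideal_set J -> I = J.
Proof.
case: I J => [I hI] [J hJ] /= IJ; case: _ / IJ hJ => hJ.
by rewrite (Prop_irrelevance hI hJ).
Qed.

Lemma ideal0 (I : set M) : is_ideal M I -> I \bot.
Proof. by move=> [[x Ix] dI _]; exact: dI (le0x x) Ix. Qed.

Lemma is_ideal_gen (U : set M) : is_ideal M (ideal_gen U).
Proof.
split.
- by exists \bot => I [/ideal0].
- by move=> x y xy Uy I [hI UI]; case: (hI) => _ /(_ x y xy) + _; apply; apply: Uy.
- move=> x y Ux Uy I [hI UI]; case: (hI) => _ _; apply.
    exact: Ux.
  exact: Uy.
Qed.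

Lemma is_idealI (I J : ideal) : is_ideal M (ideal_set I `&` ideal_set J)%classic.
Proof.
case: I J => [I hI] [J hJ] /=; split.
- by exists \bot; split; apply: ideal0.
- move=> x y xy [Iy Jy]; case: hI hJ => _ dI _ [_ dJ _].
  by split; [exact: dI Iy | exact: dJ Jy].
- move=> x y [Ix Jx] [Iy Jy]; case: hI hJ => _ _ uI [_ _ uJ].
  by split; [exact: uI | exact: uJ].
Qed.

Lemma is_ideal_bot : is_ideal M [set (\bot : M)].
Proof.
split=> [|x y xy /= y0|x y /= -> ->]; first by exists \bot.
- by apply/eqP; rewrite -lex0 -y0.
- by rewrite joinxx.
Qed.

Lemma is_ideal_setT : is_ideal M [set: M].
Proof. by split=> //; exists \bot. Qed.

Definition ideal_le (I J : ideal) : bool :=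
  `[< (ideal_set I `<=` ideal_set J)%classic >].
Definition ideal_meet (I J : ideal) : ideal := Ideal (is_idealI I J).
Definition ideal_join (I J : ideal) : ideal :=
  Ideal (is_ideal_gen (ideal_set I `|` ideal_set J)%classic).

Lemma ideal_le_refl : reflexive ideal_le.
Proof. by move=> I; apply/asboolP. Qed.

Lemma ideal_le_anti : antisymmetric ideal_le.
Proof.
move=> I J /andP[/asboolP IJ /asboolP JI]; apply: ideal_ext.
by apply/seteqP; split.
Qed.

Lemma ideal_le_trans : transitive ideal_le.
Proof.
by move=> J I K /asboolP IJ /asboolP JK; apply/asboolP; apply: subset_trans JK.
Qed.

Lemma ideal_meetP (I J K : ideal) :
  ideal_le I (ideal_meet J K) = ideal_le I J && ideal_le I K.
Proof.
apply/asboolP/andP => [IJK|[/asboolP IJ /asboolP IK] x Ix].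
  by split; apply/asboolP => x /IJK[].
by split; [exact: IJ | exact: IK].
Qed.

Lemma ideal_joinP (I J K : ideal) :
  ideal_le (ideal_join I J) K = ideal_le I K && ideal_le J K.
Proof.
apply/asboolP/andP => [IJK|[/asboolP IK /asboolP JK] x].
  split; apply/asboolP => x Ix; apply: IJK => A [_]; apply; first by left.
  by right.
by apply; split; [exact: ideal_setP | move=> y [/IK|/JK]].
Qed.

HB.instance Definition _ := gen_eqMixin ideal.
HB.instance Definition _ := gen_choiceMixin ideal.
HB.instance Definition _ := @Order.Le_isPOrder.Build d ideal
  ideal_le ideal_le_refl ideal_le_anti ideal_le_trans.
HB.instance Definition _ := @Order.POrder_MeetJoin_isLattice.Build d ideal
  ideal_meet ideal_join ideal_meetP ideal_joinP.

Lemma ideal_le0x (I : ideal) : Ideal is_ideal_bot <= I.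
Proof. by apply/asboolP => x /= ->; exact: ideal0 (ideal_setP I). Qed.

Lemma ideal_lex1 (I : ideal) : I <= Ideal is_ideal_setT.
Proof. by apply/asboolP. Qed.

HB.instance Definition _ := @Order.hasBottom.Build d ideal _ ideal_le0x.
HB.instance Definition _ := @Order.hasTop.Build d ideal _ ideal_lex1.

End IdealLattice.

Section QuotientLattice.
Context {d : Order.disp_t} {M : latticeType d}.

Record congruence : Type := Congruence {
  congruence_rel :> equiv_rel M;
  congruence_meet : forall x x' y y' : M,
    congruence_rel x x' -> congruence_rel y y' ->
    congruence_rel (x `&` y) (x' `&` y');
  congruence_join : forall x x' y y' : M,
    congruence_rel x x' -> congruence_rel y y' ->
    congruence_rel (x `|` y) (x' `|` y') }.

Definition congruence_class (theta : congruence) (x : M) : set M :=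
  [set y | theta x y].

Variable theta : congruence.

Definition quotient_lattice : Type := {eq_quot theta}.

HB.instance Definition _ := Choice.on quotient_lattice.

Let pi (x : M) : quotient_lattice := \pi_{eq_quot theta} x.
Let repr_ (x : quotient_lattice) : M := repr (x : {eq_quot theta}).

Definition quotient_meet (x y : quotient_lattice) : quotient_lattice :=
  pi (repr_ x `&` repr_ y).
Definition quotient_join (x y : quotient_lattice) : quotient_lattice :=
  pi (repr_ x `|` repr_ y).
Definition quotient_le (x y : quotient_lattice) : bool :=
  quotient_meet x y == x.

Let piP (x y : M) : pi x = pi y <-> theta x y.
Proof. by split=> [/eqquotP|xy]; [|apply/eqquotP]. Qed.

Let piK (x : quotient_lattice) : pi (repr_ x) = x.
Proof. exact: reprK. Qed.

Let reprP (x : M) : theta (repr_ (pi x)) x.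
Proof. exact/piP/piK. Qed.

Lemma quotient_meetE (x y : M) : quotient_meet (pi x) (pi y) = pi (x `&` y).
Proof. by apply/piP; apply: congruence_meet; apply: reprP. Qed.

Lemma quotient_joinE (x y : M) : quotient_join (pi x) (pi y) = pi (x `|` y).
Proof. by apply/piP; apply: congruence_join; apply: reprP. Qed.

Lemma quotient_meetC : commutative quotient_meet.
Proof. by move=> x y; rewrite /quotient_meet meetC. Qed.

Lemma quotient_joinC : commutative quotient_join.
Proof. by move=> x y; rewrite /quotient_join joinC. Qed.

Lemma quotient_meetA : associative quotient_meet.
Proof.
move=> x y z; rewrite -(piK x) -(piK y) -(piK z).
by rewrite !quotient_meetE meetA.
Qed.

Lemma quotient_joinA : associative quotient_join.
Proof.
move=> x y z; rewrite -(piK x) -(piK y) -(piK z).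
by rewrite !quotient_joinE joinA.
Qed.

Lemma quotient_meetxx : idempotent_op quotient_meet.
Proof. by move=> x; rewrite -(piK x) quotient_meetE meetxx. Qed.

Lemma quotient_joinKI y x : quotient_meet x (quotient_join x y) = x.
Proof. by rewrite -(piK x) -(piK y) quotient_joinE quotient_meetE joinKI. Qed.

Lemma quotient_meetKU y x : quotient_join x (quotient_meet x y) = x.
Proof. by rewrite -(piK x) -(piK y) quotient_meetE quotient_joinE meetKU. Qed.

Lemma quotient_le_refl : reflexive quotient_le.
Proof. by move=> x; apply/eqP/quotient_meetxx. Qed.

Lemma quotient_le_anti : antisymmetric quotient_le.
Proof.
by move=> x y /andP[/eqP xy /eqP yx]; rewrite -xy quotient_meetC yx.
Qed.

Lemma quotient_le_trans : transitive quotient_le.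
Proof.
move=> y x z /eqP xy /eqP yz; apply/eqP.
by rewrite -{1}xy -quotient_meetA yz xy.
Qed.

HB.instance Definition _ := @Order.Le_isPOrder.Build d quotient_lattice
  quotient_le quotient_le_refl quotient_le_anti quotient_le_trans.
HB.instance Definition _ := @Order.POrder_isLattice.Build d quotient_lattice
  quotient_meet quotient_join quotient_meetC quotient_joinC
  quotient_meetA quotient_joinA quotient_joinKI quotient_meetKU
  (fun _ _ => erefl).

End QuotientLattice.

Arguments congruence {d} M.

Section Annihilators.
Context {d : Order.disp_t} (M : tbLatticeType d).
Implicit Types (U : set M) (a : M) (s : size_bound).

Definition annihilator U : set M := [set x | forall u, U u -> x `&` u = \bot].

Definition annihilator1 a : set M := [set x | x `&` a = \bot].

Definition small_annihilators s : set (set M) :=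
  [set annihilator U | U in [set U | small s U]].

Definition annihilators : set (set M) := small_annihilators AnyNumber.

Definition PAnn : set (set M) := [set annihilator1 a | a in [set: M]].

Definition P2Ann : set (set M) :=
  [set annihilator (annihilator1 a) | a in [set: M]].

Definition stone : Prop :=
  forall a, exists2 e, complemented M e & annihilator1 a = principal_ideal e.

Definition annihilator_meet_law : Prop :=
  forall a b : M, annihilator1 (a `&` b) =
    ideal_gen (annihilator1 a `|` annihilator1 b)%classic.

Definition condition1 s : Prop :=
  forall U, small s U ->
    exists2 e, complemented M e & annihilator U = principal_ideal e.

Definition condition2 s : Prop :=
  stone /\ complete_boolean_sublattice s (complemented M).

(* The first conjunct is the inclusion of P2Ann M in Id(M); it is part of the
   assertion, since annihilators of a nondistributive lattice need not be
   ideals. The operations of the sublattice P2Ann M are those of Id(M). *)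
Definition condition3 s : Prop :=
  [/\ (P2Ann `<=` is_ideal M)%classic,
      complete_boolean_sublattice s [set I : ideal M | P2Ann (ideal_set I)] &
      exists f : M -> ideal M,
        [/\ forall a, ideal_set (f a) = annihilator (annihilator1 a),
            Order.meet_morphism f & Order.join_morphism f]].

Definition condition4 s : Prop :=
  annihilator_meet_law /\
  forall U, small s U -> PAnn (annihilator (annihilator U)).

Definition condition5 s : Prop :=
  forall U, small s U ->
    ideal_gen (annihilator U `|` annihilator (annihilator U))%classic = [set: M].

Variant condition_index := C1 | C2 | C3 | C4 | C5.

Definition condition (h : condition_index) : size_bound -> Prop :=
  match h with
  | C1 => condition1
  | C2 => condition2
  | C3 => condition3
  | C4 => condition4
  | C5 => condition5
  end.

End Annihilators.

Arguments small_annihilators {d} M s _.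
Arguments annihilators {d} M _.
Arguments PAnn {d} M _.
Arguments P2Ann {d} M _.

(* Main.v *)
(* Since theta only identifies 0 and 1 with themselves, the relations
   x `&` y = 0 and x `|` y = 1 can be tested in the distributive quotient; as
   complemented elements are greatest in their classes, it follows that
   complemented elements form a Boolean sublattice, that annihilators are
   ideals, and that Ann(f) is the principal ideal of e when e and f are
   complements. All conditions are then compared with the first one. In a Stone
   lattice each a has the same annihilator as a unique complemented element, its
   support, and a |-> support of a is a lattice morphism; P2Ann is the image of
   the complemented elements under the embedding of M in Id(M). For finite sets,
   or when annihilators of small sets are principal, the first condition is just
   the Stone property. *)
Require Import Defs.
From mathcomp Require Import all_boot all_order generic_quotient.
From mathcomp Require Import boolp classical_sets functions cardinality.

Set Implicit Arguments.
Unset Strict Implicit.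
Unset Printing Implicit Defensive.

Import Order.TTheory.

Local Open Scope classical_set_scope.
Local Open Scope card_scope.
Local Open Scope order_scope.


(** * Smallness of sets *)

Lemma small_image (s : size_bound) (T T' : Type) (f : T -> T') (U : set T) :
  small s U -> small s (f @` U).
Proof.
case: s => [K||] //=; last exact: finite_image.
exact/card_le_trans/card_image_le.
Qed.

(** Excludes the zero cardinality: conditions on small sets then apply to singletons, that is, to
    annihilators of single elements. *)
Definition unital (s : size_bound) : Prop :=
  forall (T : Type) (a : T), small s [set a].

Lemma unital_AtMost (K : Type) : [set: K] !=set0 -> unital (AtMost K).
Proof.
move=> [k _] T a; apply: (card_le_trans _ (card_image_le (fun=> a) [set: K])).
by apply: subset_card_le => _ ->; exists k.
Qed.

Lemma unital_FinitelyMany : unital FinitelyMany.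
Proof. by move=> T a; exact: finite_set1. Qed.

(** * Generated and principal ideals *)

Section Ideals.
Context {d : Order.disp_t} {M : tbLatticeType d}.
Implicit Types (I J : set M) (x a b e : M).

Lemma principal_idealE a : principal_ideal a = [set x | x <= a].
Proof.
apply/seteqP; split=> [x|x xa I [[_ dI _] Ia]]; last first.
  by apply: dI xa _; exact: Ia.
apply; split=> [|_ ->//=]; split=> [|x' y xy /= ya|x' y /= xa ya].
- by exists a => /=.
- exact: le_trans ya.
- by rewrite leUx xa.
Qed.

Lemma ideal_gen_setU I J : is_ideal M I -> is_ideal M J ->
  ideal_gen (I `|` J)%classic =
    [set x | exists i j, [/\ I i, J j & x <= i `|` j]].
Proof.
move=> hI hJ; apply/seteqP; split=> [x|x [i [j [Ii Jj xij]]] A [[_ dA jA] IJA]].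
  apply; split=> [|y [Iy|Jy]].
  - split=> [|y z yz [i [j [Ii Jj zij]]]|
      y z [i [j [Ii Jj yij]]] [k [l [Ik Jl zkl]]]].
    + exists \bot; exists \bot, \bot.
      by split; [exact: ideal0|exact: ideal0|exact: le0x].
    + by exists i, j; split=> //; exact: le_trans zij.
    + exists (i `|` k), (j `|` l); split.
      * by case: hI => _ _; apply.
      * by case: hJ => _ _; apply.
      * by rewrite joinACA leU2.
  - by exists y, \bot; rewrite leUl; split=> //; exact: ideal0.
  - by exists \bot, y; rewrite leUr; split=> //; exact: ideal0.
by apply: dA xij _; apply: jA; apply: IJA; [left|right].
Qed.

Definition pideal a : ideal M :=
  @Ideal _ _ (principal_ideal a) (is_ideal_gen [set a]).

Lemma pidealE a : pideal a = [set x | x <= a] :> set M.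
Proof. exact: principal_idealE. Qed.

Lemma pideal_inj : injective pideal.
Proof.
move=> a b /(congr1 (@ideal_set _ _)); rewrite !pidealE => /seteqP[ab ba].
by apply: le_anti; rewrite (ab a (lexx a)) (ba b (lexx b)).
Qed.

Lemma pideal0 : pideal \bot = \bot.
Proof.
apply: ideal_ext; rewrite pidealE; apply/seteqP; split=> x /=.
  by rewrite lex0 => /eqP.
by move=> ->; rewrite lexx.
Qed.

Lemma pideal1 : pideal \top = \top.
Proof.
apply: ideal_ext; rewrite pidealE.
by apply/seteqP; split=> x //= _; exact: lex1.
Qed.

Lemma pidealI a b : pideal (a `&` b) = pideal a `&` pideal b.
Proof.
apply: ideal_ext; rewrite /= !principal_idealE.
by apply/seteqP; split=> x /=; rewrite lexI => /andP.
Qed.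

Lemma pidealU a b : pideal (a `|` b) = pideal a `|` pideal b.
Proof.
apply: ideal_ext; rewrite pidealE /=.
rewrite ideal_gen_setU; [|exact: is_ideal_gen|exact: is_ideal_gen].
rewrite !principal_idealE.
apply/seteqP; split=> x /=; first by exists a, b; rewrite !lexx.
by move=> [i [j [ia jb xij]]]; apply: le_trans xij _; exact: leU2.
Qed.

End Ideals.

(** * Boolean sublattices under a lattice embedding *)

Section Transfer.
Context {d d' : Order.disp_t} {L : tbLatticeType d} {L' : tbLatticeType d'}.
Context (f : L -> L') (f_inj : injective f).
Context (f0 : f \bot = \bot) (f1 : f \top = \top).
Context (fI : Order.meet_morphism f) (fU : Order.join_morphism f).

Lemma embedding_le x y : (f x <= f y) = (x <= y).
Proof.
apply/idP/idP => /meet_idPl xy; apply/meet_idPl; last by rewrite -fI xy.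
by apply: f_inj; rewrite fI.
Qed.

(** Suprema and infima are taken inside [S], so an injective morphism, which also reflects the
    order, carries them both ways. Applied below to [pideal]. *)
Lemma complete_boolean_image (s : size_bound) (S : set L) :
  complete_boolean_sublattice s (f @` S) <-> complete_boolean_sublattice s S.
Proof.
have fS x : (f @` S) (f x) <-> S x.
  by split=> [[y Sy /f_inj<-]//|Sx]; exists x.
have fsup V v : supremum_in (f @` S) (f @` V) (f v) <-> supremum_in S V v.
  split=> -[Sv Vv vw]; split=> [|x Vx|w Sw Vw].
  - exact/fS.
  - by rewrite -embedding_le; apply: Vv; exists x.
  - rewrite -embedding_le; apply: vw => [|_ [x Vx <-]]; first exact/fS.
    by rewrite embedding_le; exact: Vw.
  - exact/fS.
  - by case: Vx => y Vy <-; rewrite embedding_le; exact: Vv.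
  - case: Sw Vw => y Sy <- Vw; rewrite embedding_le; apply: vw => // x Vx.
    by rewrite -embedding_le; apply: Vw; exists x.
have finf V v : infimum_in (f @` S) (f @` V) (f v) <-> infimum_in S V v.
  split=> -[Sv Vv vw]; split=> [|x Vx|w Sw Vw].
  - exact/fS.
  - by rewrite -embedding_le; apply: Vv; exists x.
  - rewrite -embedding_le; apply: vw => [|_ [x Vx <-]]; first exact/fS.
    by rewrite embedding_le; exact: Vw.
  - exact/fS.
  - by case: Vx => y Vy <-; rewrite embedding_le; exact: Vv.
  - case: Sw Vw => y Sy <- Vw; rewrite embedding_le; apply: vw => // x Vx.
    by rewrite -embedding_le; apply: Vw; exists x.
split=> -[[[S0 S1 SI SU] Sdistr Scompl] Scomplete]; split=> [|V VS Vs].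
- split; first split.
  + by apply/fS; rewrite f0.
  + by apply/fS; rewrite f1.
  + by move=> x y /fS Sx /fS Sy; apply/fS; rewrite fI; exact: SI.
  + by move=> x y /fS Sx /fS Sy; apply/fS; rewrite fU; exact: SU.
  + move=> x y z /fS Sx /fS Sy /fS Sz; apply: f_inj.
    by rewrite fI !fU !fI; exact: Sdistr.
  + move=> x /fS /Scompl[_ [y Sy <-] [xy0 xy1]]; exists y => //.
    by split; apply: f_inj; rewrite ?fI ?fU ?f0 ?f1.
- have fVS : (f @` V `<=` f @` S)%classic by exact: image_subset.
  have [[v vV] [w wV]] := Scomplete _ fVS (small_image f Vs).
  have [[v' _ v'v] _ _] := vV; have [[w' _ w'w] _ _] := wV.
  split; first by exists v'; apply/fsup; rewrite v'v.
  by exists w'; apply/finf; rewrite w'w.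
- split; first split.
  + by exists \bot.
  + by exists \top.
  + move=> _ _ [x Sx <-] [y Sy <-]; rewrite -fI.
    by exists (x `&` y); first exact: SI.
  + move=> _ _ [x Sx <-] [y Sy <-]; rewrite -fU.
    by exists (x `|` y); first exact: SU.
  + move=> _ _ _ [x Sx <-] [y Sy <-] [z Sz <-].
    by rewrite -fU -!fI -fU Sdistr.
  + move=> _ [x /Scompl[y Sy [xy0 xy1]] <-]; exists (f y); first by exists y.
    by split; rewrite -?fI -?fU ?xy0 ?xy1.
(* A left inverse of [f]; the default [\bot] is never met, because [g] is applied only inside the
   image of [f]. *)
- pose g y := xget \bot [set x | f x = y].
  have gf x : g (f x) = x.
    by apply: f_inj; rewrite /g; case: xgetP => [y -> //|/(_ x)/(_ erefl)].
  have gVS : (g @` V `<=` S)%classic.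
    by move=> _ [y /VS[x Sx <-] <-]; rewrite gf.
  have fgV : f @` (g @` V) = V.
    apply/seteqP; split=> [_ [_ [y Vy <-] <-]|y Vy].
      by have [x _ yx] := VS _ Vy; rewrite -yx gf yx.
    by have [x _ yx] := VS _ Vy; exists x => //; exists y => //; rewrite -yx gf.
  have [[v vV] [w wV]] := Scomplete _ gVS (small_image g Vs).
  by split; [exists (f v)|exists (f w)]; rewrite -fgV; [exact/fsup|exact/finf].
Qed.

End Transfer.

(** * Annihilators and double annihilators *)

Section AnnihilatorBasics.
Context {d : Order.disp_t} {M : tbLatticeType d}.
Implicit Types (U : set M) (a b x : M).

Lemma annihilator_set1 a : annihilator [set a] = annihilator1 a.
Proof. by apply/seteqP; split=> x /= xa; [exact: xa|move=> _ ->]. Qed.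

Lemma eq_annihilator1 a b :
  (forall x, x `&` a = \bot <-> x `&` b = \bot) ->
  annihilator1 a = annihilator1 b.
Proof. by move=> ab; apply/seteqP; split=> x /ab. Qed.

Lemma annihilator_principal a :
  annihilator (principal_ideal a) = annihilator1 a.
Proof.
rewrite principal_idealE; apply/seteqP; split=> x xa; first exact: xa (lexx a).
by move=> u ua; apply/eqP; rewrite -lex0 -xa leI2.
Qed.

(** Orthogonality is symmetric, so [annihilator] is a Galois connection of the subsets of [M] with
    themselves. *)
Lemma annihilatorK U :
  annihilator (annihilator (annihilator U)) = annihilator U.
Proof.
apply/seteqP; split=> x xU u Uu.
  by apply: xU => y /(_ u Uu); rewrite meetC.
by rewrite meetC; exact: Uu.
Qed.

Lemma annihilator1K a :
  annihilator (annihilator (annihilator1 a)) = annihilator1 a.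
Proof. by rewrite -annihilator_set1 annihilatorK. Qed.

End AnnihilatorBasics.

(* The congruence is only used to obtain the next three properties and the
   equality between annihilators and principal annihilators. *)
Definition zero_distributive (d : Order.disp_t) (L : tbLatticeType d) : Prop :=
  forall x y z : L, x `&` y = \bot -> x `&` z = \bot -> x `&` (y `|` z) = \bot.

Definition one_distributive (d : Order.disp_t) (L : tbLatticeType d) : Prop :=
  forall x y z : L, x `|` y = \top -> x `|` z = \top -> x `|` (y `&` z) = \top.

Definition complements_dominate (d : Order.disp_t) (L : tbLatticeType d) :
    Prop :=
  forall e f x : L, is_complement e f -> x `&` f = \bot -> x <= e.

(** * Complemented elements, supports and the five conditions *)

Section Equivalences.
Context {d : Order.disp_t} {M : tbLatticeType d}.
Context (M0 : zero_distributive M) (M1 : one_distributive M).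
Context (Mdom : complements_dominate M).
Implicit Types (U V : set M) (a b e f x y z : M) (s : size_bound).

Lemma annihilator_ideal U : is_ideal M (annihilator U).
Proof.
split=> [|x y xy yU u Uu|x y xU yU u Uu].
- by exists \bot => u _; rewrite meet0x.
- by apply/eqP; rewrite -lex0 -(yU u Uu) leI2.
- by rewrite meetC; apply: M0; rewrite meetC; [exact: xU|exact: yU].
Qed.

Lemma meet_join0 a b x :
  x `&` (a `|` b) = \bot <-> x `&` a = \bot /\ x `&` b = \bot.
Proof.
split=> [xab|[xa xb]]; last exact: M0.
by split; apply/eqP; rewrite -lex0 -xab leI2 // ?leUl ?leUr.
Qed.

Lemma is_complement_sym e f : is_complement e f -> is_complement f e.
Proof. by rewrite /is_complement meetC joinC. Qed.

Lemma complement_le e f x : is_complement e f -> (x <= e <-> x `&` f = \bot).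
Proof.
move=> ef; split=> [xe|]; last exact: Mdom.
by apply/eqP; rewrite -lex0 -ef.1 leI2.
Qed.

Lemma is_complementI e e' f f' : is_complement e f -> is_complement e' f' ->
  is_complement (e `&` e') (f `|` f').
Proof.
move=> [ef0 ef1] [ef0' ef1']; split.
  by apply: M0; [rewrite meetAC ef0 meet0x|rewrite -meetA ef0' meetx0].
rewrite joinC; apply: M1; first by rewrite joinAC [f `|` e]joinC ef1 join1x.
by rewrite -joinA [f' `|` e']joinC ef1' joinx1.
Qed.

Lemma is_complementU e e' f f' : is_complement e f -> is_complement e' f' ->
  is_complement (e `|` e') (f `&` f').
Proof.
move=> /is_complement_sym ef /is_complement_sym ef'.
exact/is_complement_sym/is_complementI.
Qed.

Lemma complemented0 : complemented M \bot.
Proof. by exists \top; split; rewrite ?meet0x ?joinx1. Qed.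

Lemma complemented_boolean : boolean_sublattice (complemented M).
Proof.
split; first split.
- exact: complemented0.
- by exists \bot; split; rewrite ?meetx0 ?join1x.
- by move=> x y [x' xx'] [y' yy']; exists (x' `|` y'); exact: is_complementI.
- by move=> x y [x' xx'] [y' yy']; exists (x' `&` y'); exact: is_complementU.
(* The nontrivial inequality is tested against a complement of its right-hand side; the meet to be
   shown zero splits over [y] and [z] by [M0]. *)
- move=> x y z [x' xx'] [y' yy'] [z' zz']; apply: le_anti; apply/andP; split.
    rewrite (complement_le _ (is_complementU (is_complementI xx' yy')
      (is_complementI xx' zz'))).
    rewrite meetAC; apply: M0.
      rewrite meetAC; apply: (@le_anti _ M); rewrite le0x andbT.
      by rewrite -(is_complementI xx' yy').1 leI2 // leIl.
    rewrite meetAC; apply: (@le_anti _ M); rewrite le0x andbT.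
    by rewrite -(is_complementI xx' zz').1 leI2 // leIr.
  by rewrite leUx !leI2 ?leUl ?leUr.
- by move=> x [x' xx']; exists x' => //; exists x; exact: is_complement_sym.
Qed.

Lemma annihilator1_complement e f :
  is_complement e f -> annihilator1 f = principal_ideal e.
Proof.
move=> ef; rewrite principal_idealE.
by apply/seteqP; split=> x; rewrite /annihilator1 /= (complement_le _ ef).
Qed.

(** The default [\bot] occurs only for elements without a complement. *)
Definition complement e : M := xget \bot [set f | is_complement e f].

Lemma complementP e : complemented M e -> is_complement e (complement e).
Proof. by rewrite /complement => -[f ef]; case: xgetP => [g _ //|/(_ f)]. Qed.

Lemma complemented_complement e :
  complemented M e -> complemented M (complement e).
Proof. by move=> Be; exists e; exact/is_complement_sym/complementP. Qed.

(** Passing to a complement of the generator exchanges a principal ideal and the annihilator of one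
    element. *)
Lemma condition1P s :
  condition1 M s <->
  forall U, small s U ->
    exists2 e, complemented M e & annihilator U = annihilator1 e.
Proof.
split=> H U /H[e Be ->]; exists (complement e).
- exact: complemented_complement.
- by rewrite (annihilator1_complement (complementP Be)).
- exact: complemented_complement.
- exact/annihilator1_complement/is_complement_sym/complementP.
Qed.

(* This amounts to: e is complemented and generates the double annihilator
   of a. *)
Definition support a e : Prop :=
  complemented M e /\ annihilator1 a = annihilator1 e.

Lemma supportE a e x : support a e -> (x `&` a = \bot <-> x `&` e = \bot).
Proof. by move=> [_ /seteqP[ae ea]]; split=> [/ae|/ea]. Qed.

(** Orthogonality to an element depends only on its support, so [a] and [b] can be replaced one at a
    time inside a meet. *)
Lemma supportI a b e f :
  support a e -> support b f -> support (a `&` b) (e `&` f).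
Proof.
move=> ae bf; split.
  by have [[_ _ + _] _ _] := complemented_boolean; apply; [case: ae|case: bf].
apply: eq_annihilator1 => x; rewrite meetA (supportE _ bf) meetAC.
by rewrite (supportE _ ae) meetAC meetA.
Qed.

Lemma supportU a b e f :
  support a e -> support b f -> support (a `|` b) (e `|` f).
Proof.
move=> ae bf; split.
  by have [[_ _ _ +] _ _] := complemented_boolean; apply; [case: ae|case: bf].
apply: eq_annihilator1 => x.
by rewrite !meet_join0 (supportE _ ae) (supportE _ bf).
Qed.

(** The annihilator of one of two complementary elements is the ideal of the other, so two
    annihilators lead back to [e]. *)
Lemma support_annihilator2 a e :
  support a e -> annihilator (annihilator1 a) = principal_ideal e.
Proof.
move=> [Be ->]; have ef := complementP Be.
by rewrite (annihilator1_complement (is_complement_sym ef))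
  annihilator_principal (annihilator1_complement ef).
Qed.

(** A support of [a] is a complement of the generator of its annihilator; choice makes it a
    function. *)
Lemma stoneP : stone M <-> exists p : M -> M, forall a, support a (p a).
Proof.
split=> [stM|[p pP] a]; last first.
  have [Bp ->] := pP a; exists (complement (p a)).
    exact: complemented_complement.
  exact/annihilator1_complement/is_complement_sym/complementP.
have [p pP] : {p : M -> M & forall a, support a (p a)}.
  apply: choice => a; have [e Be ae] := stM a.
  exists (complement e); split; first exact: complemented_complement.
  by rewrite ae (annihilator1_complement (complementP Be)).
by exists p.
Qed.

Lemma condition1_stone s : unital s -> condition1 M s -> stone M.
Proof.
move=> s1 H a; have [e Be ae] := H [set a] (s1 _ a).
by exists e; rewrite -?annihilator_set1.
Qed.

Lemma condition1_complete s : condition1 M s ->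
  complete_boolean_sublattice s (complemented M).
Proof.
move=> /condition1P H; split=> [|V VB Vs]; first exact: complemented_boolean.
split.
  (* This [e] is the supremum: a complemented element bounds [V] exactly when its complement
     annihilates [V]. *)
  have [e Be /seteqP[Ve eV]] := H V Vs; exists e.
  have ef := complementP Be; split=> // [v Vv|w Bw Vw].
    rewrite (complement_le _ ef) meetC; apply: eV => //.
    by rewrite /annihilator1 /= meetC ef.1.
  have wg := complementP Bw.
  rewrite (complement_le _ wg) meetC; apply: Ve => v Vv.
  by rewrite meetC -(complement_le _ wg); exact: Vw.
(* Dually, the infimum is the complement of the element obtained from the complements of the members
   of [V]. *)
have [f Bf /seteqP[Vf fV]] := H _ (small_image complement Vs).
have fe := complementP Bf; set e := complement f in fe.
have ef := is_complement_sym fe; exists e; split=> [|v Vv|w Bw Vw].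
- by exists f.
- rewrite (complement_le _ (complementP (VB _ Vv))).
  by apply: fV; [exact: ef.1|exists v].
- rewrite (complement_le _ ef); apply: Vf => _ [v Vv <-].
  by rewrite -(complement_le _ (complementP (VB _ Vv))); exact: Vw.
Qed.

(** For the converse, a small set has the same annihilator as the supremum of the supports of its
    elements. *)
Lemma condition12 s : unital s -> condition1 M s <-> condition2 M s.
Proof.
move=> s1; split=> [H|[/stoneP[p pP] [_ H]]].
  by split; [exact: condition1_stone H|exact: condition1_complete].
apply/condition1P => U Us; have pU : (p @` U `<=` complemented M)%classic.
  by move=> _ [u _ <-]; case: (pP u).
(* The supremum v is only one within the complemented elements; an arbitrary
   x orthogonal to U is reached through the complement of its support. *)
have [[v [Bv Uv vU]] _] := H _ pU (small_image p Us).
exists v => //; apply/seteqP; split=> [x xU|x xv u Uu].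
  have xe := complementP (pP x).1.
  rewrite /annihilator1 /= meetC (supportE _ (pP x)).
  rewrite -(complement_le _ (is_complement_sym xe)).
  apply: vU; first exact: complemented_complement (pP x).1.
  move=> _ [u Uu <-]; rewrite (complement_le _ (is_complement_sym xe)).
  by rewrite -(supportE _ (pP x)) meetC -(supportE _ (pP u)); exact: xU.
rewrite (supportE _ (pP u)); apply: (@le_anti _ M).
rewrite le0x andbT -xv leI2 //.
by apply: Uv; exists u.
Qed.

(** A double annihilator is the principal ideal of a support, and a complemented element is its own
    support. *)
Lemma stone_P2Ann : stone M ->
  [set I : ideal M | P2Ann M (ideal_set I)] = pideal @` complemented M.
Proof.
move=> /stoneP[p pP]; apply/seteqP; split=> [I [a _ aI]|_ [e Be <-]].
  exists (p a); first by case: (pP a).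
  by apply: ideal_ext; rewrite -aI (support_annihilator2 (pP a)).
by exists e => //; rewrite (@support_annihilator2 e e).
Qed.

Lemma P2Ann_stone :
  boolean_sublattice [set I : ideal M | P2Ann M (ideal_set I)] -> stone M.
Proof.
move=> [_ _ H] a; pose I := Ideal (annihilator_ideal (annihilator1 a)).
have [|J _ [IJ0 IJ1]] := H I; first by exists a.
have : ideal_set (I `|` J) \top by rewrite IJ1.
rewrite /= ideal_gen_setU; [|exact: annihilator_ideal|exact: ideal_setP].
(* Splitting [\top] over the complementary ideals [I] and [J] gives complementary elements; [y] will
   generate the annihilator of [a]. *)
move=> [x [y [Ix Jy xy1]]].
have IJ z : annihilator (annihilator1 a) z -> ideal_set J z -> z = \bot.
  move=> Iz Jz; have : ideal_set (I `&` J) z by split.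
  by rewrite IJ0.
have [_ dI _] := annihilator_ideal (annihilator1 a).
have [_ dJ _] := ideal_setP J.
have xyP : is_complement x y.
  split; last by apply/eqP; rewrite -le1x.
  by apply: IJ; [exact: dI (leIl _ _) Ix|exact: dJ (leIr _ _) Jy].
exists y; first by exists x; exact: is_complement_sym.
rewrite -(annihilator1_complement (is_complement_sym xyP)).
apply/seteqP; split=> z za; first by rewrite /annihilator1 /= meetC; exact: Ix.
(* Every [t] in the double annihilator is orthogonal to [y], hence below [x]; so anything orthogonal
   to [x] is orthogonal to [t]. *)
rewrite -annihilator1K => t It; apply: (@le_anti _ M).
rewrite le0x andbT -za leI2 //.
apply: (Mdom xyP); apply: IJ; first exact: dI (leIl _ _) It.
exact: dJ (leIr _ _) Jy.
Qed.

Lemma condition23 s : condition2 M s <-> condition3 M s.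
Proof.
have transfer := @complete_boolean_image _ _ _ _ (@pideal _ M) pideal_inj
  pideal0 pideal1 pidealI pidealU s (complemented M).
split=> [[stM HB]|[_ HB _]]; last first.
  have stM : stone M by case: HB => /P2Ann_stone.
  by split=> //; apply/transfer; rewrite -stone_P2Ann.
split=> [_ [a _ <-]||]; first exact: annihilator_ideal.
  by rewrite stone_P2Ann //; exact/transfer.
have /stoneP[p pP] := stM.
exists (fun a => Ideal (annihilator_ideal (annihilator1 a))).
(* The map is [p] followed by [pideal]. Since any support of an element yields the same ideal, [p]
   itself need not be shown to be a morphism. *)
have fE a : Ideal (annihilator_ideal (annihilator1 a)) = pideal (p a).
  by apply: ideal_ext; exact: support_annihilator2.
split=> // a b; rewrite !fE.
  rewrite -pidealI; apply: ideal_ext.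
  rewrite -[LHS](support_annihilator2 (pP (a `&` b))).
  exact/support_annihilator2/supportI.
rewrite -pidealU; apply: ideal_ext.
rewrite -[LHS](support_annihilator2 (pP (a `|` b))).
exact/support_annihilator2/supportU.
Qed.

(** Once [a] and [b] are replaced by their supports, the annihilators are principal ideals of
    complements and the meet law is a De Morgan law. *)
Lemma condition14 s : unital s -> condition1 M s -> condition4 M s.
Proof.
move=> s1 H; have /stoneP[p pP] := condition1_stone s1 H.
split=> [a b|U Us].
  have [[_ pa] [_ pb]] := (pP a, pP b).
  have ca := is_complement_sym (complementP (pP a).1).
  have cb := is_complement_sym (complementP (pP b).1).
  rewrite (supportI (pP a) (pP b)).2 pa pb.
  rewrite (annihilator1_complement (is_complementU ca cb)).
  rewrite !(annihilator1_complement ca, annihilator1_complement cb).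
  by have /(congr1 (@ideal_set _ M)) :=
    pidealU (complement (p a)) (complement (p b)).
have /condition1P/(_ U Us)[e Be ->] := H; exists (complement e) => //.
rewrite (annihilator1_complement (complementP Be)).
by rewrite (@support_annihilator2 e e).
Qed.

Lemma condition45 s : unital s -> condition4 M s -> condition5 M s.
Proof.
move=> s1 [meet_law H] U Us; have [a _ aU] := H U Us.
(* Since three annihilators reduce to one, [b] has the annihilator of [U], while [a] has its double
   annihilator. So [a] and [b] are orthogonal, and the meet law yields all of [M]. *)
have [b _ ba] := H _ (s1 _ a).
rewrite annihilator_set1 aU annihilatorK in ba.
rewrite -aU -ba -meet_law; apply/seteqP; split=> // x _.
have ba0 : b `&` a = \bot.
  suff : annihilator1 b a by rewrite meetC.
  by rewrite ba -annihilatorK -aU => y; rewrite meetC.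
by rewrite /annihilator1 /= ba0 meetx0.
Qed.

(** Splitting [\top] over the two ideals gives complementary [e] and [f], and [e] generates the
    annihilator of [U]. *)
Lemma condition51 s : condition5 M s -> condition1 M s.
Proof.
move=> H U Us; have : [set: M] \top by [].
rewrite -(H U Us) ideal_gen_setU; try exact: annihilator_ideal.
move=> [e [f [eU fU ef1]]].
have ef : is_complement e f.
  by split; [rewrite meetC; exact: fU|apply/eqP; rewrite -le1x].
exists e; first by exists f.
rewrite principal_idealE; apply/seteqP; split=> x /= => [xU|xe].
  by apply: (Mdom ef); rewrite meetC; exact: fU.
by have [_ dU _] := annihilator_ideal U; exact: dU xe eU.
Qed.

Lemma condition_condition1 s h : unital s -> condition M h s <-> condition1 M s.
Proof.
move=> s1; case: h => /=.
- by [].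
- by rewrite condition12.
- by rewrite condition12 // condition23.
- by split=> [/(condition45 s1)/condition51|/(condition14 s1)].
- by split=> [/condition51|/(condition14 s1)/(condition45 s1)].
Qed.

Lemma condition_stone s h : unital s ->
  (small_annihilators M s `<=` PAnn M)%classic -> condition M h s <-> stone M.
Proof.
move=> s1 sM; rewrite condition_condition1 //.
split; first exact: condition1_stone.
move=> stM U Us; have [|a _ <-] := sM (annihilator U); first by exists U.
exact: stM.
Qed.

Lemma condition_FinitelyMany h : condition M h FinitelyMany <-> stone M.
Proof.
rewrite condition_condition1; last exact: unital_FinitelyMany.
split; first exact: condition1_stone unital_FinitelyMany.
move=> /stoneP[p pP]; apply/condition1P => _ /finite_seqP[r ->].
(* Supports are joined one by one along the enumeration, starting from [\bot], whose annihilator is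
   that of the empty set. *)
elim: r => [|a r [e Be re]].
  exists \bot; first exact: complemented0.
  by apply/seteqP; split=> x; rewrite /annihilator1 /= ?meetx0.
have ee : support e e by [].
exists (p a `|` e); first exact: (supportU (pP a) ee).1.
rewrite -(supportU (pP a) ee).2; have /seteqP[{}re er] := re.
apply/seteqP; split=> x.
  move=> xar; apply/meet_join0; split; first by apply: xar; rewrite /= mem_head.
  by apply: re => u ur; apply: xar; rewrite /= inE ur orbT.
move=> /meet_join0[xa /er xr] u; rewrite /= inE => /orP[/eqP->//|]; exact: xr.
Qed.

(** A double annihilator is an annihilator, so the hypothesis makes the second half of the fourth
    condition automatic. *)
Lemma meet_law_stone : annihilators M = PAnn M ->
  annihilator_meet_law M <-> stone M.
Proof.
move=> MP; rewrite -(@condition_stone AnyNumber C4) //; last by rewrite -MP.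
split=> [|[]//]; split=> // U _; rewrite -MP.
by exists (annihilator U).
Qed.

End Equivalences.

(** * Passage between the lattice and its quotient *)

Section Congruence.
Context {d : Order.disp_t} {M : tbLatticeType d} (theta : congruence M).
Context (theta0 : congruence_class theta \bot = [set \bot]).
Context (theta1 : congruence_class theta \top = [set \top]).
Implicit Types x y z e f : M.

Lemma congruence_eq0 x : theta x \bot -> x = \bot.
Proof.
rewrite equiv_sym => x0; have : congruence_class theta \bot x by [].
by rewrite theta0.
Qed.

Lemma congruence_eq1 x : theta x \top -> x = \top.
Proof.
rewrite equiv_sym => x1; have : congruence_class theta \top x by [].
by rewrite theta1.
Qed.

Lemma complement_congruence e f x :
  is_complement e f -> theta e x -> is_complement x f.
Proof.
rewrite equiv_sym => -[ef0 ef1] ex; have ff := equiv_refl theta f; split.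
  by apply: congruence_eq0; rewrite -ef0; exact: congruence_meet.
by apply: congruence_eq1; rewrite -ef1; exact: congruence_join.
Qed.

Local Notation Q := (quotient_lattice theta : latticeType d).
Let pi (x : M) : Q := (\pi_{eq_quot theta} x)%qT.

Lemma quotient_classI x y : (pi x `&` pi y)%O = pi (x `&` y).
Proof. exact: quotient_meetE. Qed.

Lemma quotient_classU x y : (pi x `|` pi y)%O = pi (x `|` y).
Proof. exact: quotient_joinE. Qed.

Lemma quotient_class_eq x y : pi x = pi y <-> theta x y.
Proof. by split=> [/eqquotP|xy]; [|apply/eqquotP]. Qed.

Lemma quotient_class0 x : pi x = pi \bot <-> x = \bot.
Proof. by split=> [/quotient_class_eq/congruence_eq0|->]. Qed.

Lemma quotient_class_surj (q : Q) : exists x, q = pi x.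
Proof. by exists (repr (q : {eq_quot theta}))%qT; rewrite /pi reprK. Qed.

Lemma quotient_class_ge0 x : (pi \bot <= pi x :> Q)%O.
Proof. by apply/meet_idPl; rewrite quotient_classI meet0x. Qed.

Lemma small_annihilators_sup (s : size_bound) : unital s ->
  has_small_joins s Q -> meet_distributes_small_joins s Q ->
  small_annihilators M s = PAnn M.
Proof.
move=> s1 Qsup Qdistr.
apply/seteqP; split=> [_ [U Us <-]|_ [a _ <-]]; last first.
  by exists [set a]; [exact: s1|exact: annihilator_set1].
pose V : set Q := [set pi u | u in U].
have Vs : small s V by exact: small_image.
(* [w] represents the join of the classes of [U]. Distributivity over this join puts the annihilator
   of [U] in that of [w]; the upper bound property gives the converse. *)
have [v vsup] := Qsup V Vs; have [w vw] := quotient_class_surj v.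
rewrite {v}vw in vsup.
exists w => //; apply/esym/seteqP; split=> x xU.
  have [_ wub] := Qdistr V _ (pi x) Vs vsup.
  apply/quotient_class0; rewrite -quotient_classI; apply: le_anti.
  rewrite quotient_classI quotient_class_ge0 andbT -quotient_classI.
  apply: wub => _ [_ [u Uu <-] <-].
  by rewrite quotient_classI (xU u Uu).
move=> u Uu; apply/quotient_class0; rewrite -quotient_classI.
apply: le_anti; rewrite {2}quotient_classI quotient_class_ge0 andbT.
have <- : pi (x `&` w) = pi \bot by rewrite (xU : x `&` w = \bot).
rewrite -quotient_classI leI2 //; case: vsup => + _; apply.
by exists u.
Qed.

Lemma frame_distributive : frame Q -> distributive_lattice Q.
Proof.
move=> [_ Qdistr] x y z; apply: le_anti; apply/andP; split; last first.
  by rewrite leUx !leI2 ?leUl ?leUr.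
have yz : supremums [set y; z] (y `|` z).
  split=> [_ [->|->]|t tub]; rewrite ?leUl ?leUr // leUx.
  by rewrite !tub //=; [right|left].
have [_] := Qdistr _ _ x I yz; apply=> _ [_ [->|->] <-]; first exact: leUl.
exact: leUr.
Qed.

(** * Consequences of a distributive quotient *)

Section Distributive.
Context (Qdistr : distributive_lattice Q).

Lemma distributive_zero : zero_distributive M.
Proof.
move=> x y z xy xz; apply/quotient_class0.
by rewrite -quotient_classI -quotient_classU Qdistr !quotient_classI xy xz
  quotient_classU joinxx.
Qed.

Lemma distributive_joinI (x y z : Q) :
  x `|` (y `&` z) = (x `|` y) `&` (x `|` z).
Proof.
by rewrite Qdistr [_ `&` x]meetC joinKI [(x `|` y) `&` z]meetC Qdistr joinA
  [z `&` x]meetC meetKU [z `&` y]meetC.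
Qed.

Lemma distributive_one : one_distributive M.
Proof.
move=> x y z xy xz; apply/congruence_eq1/quotient_class_eq.
by rewrite -quotient_classU -quotient_classI distributive_joinI !quotient_classU
  xy xz quotient_classI meetxx.
Qed.

Lemma distributive_dominate :
  (forall e, complemented M e -> greatest (congruence_class theta e) e) ->
  complements_dominate M.
Proof.
move=> emax e f x [ef0 ef1] xf.
have [_ eub] : greatest (congruence_class theta e) e by apply: emax; exists f.
(* In the quotient [x] lies below [e], so the join of [x] and [e] is congruent to [e], and
   maximality of [e] bounds it. *)
apply: (le_trans (leUl x e)); apply: eub; apply/quotient_class_eq.
have xe : pi x = pi (x `&` e).
  transitivity (pi (x `&` (e `|` f))); first by rewrite ef1 meetx1.
  rewrite -quotient_classI -quotient_classU Qdistr !quotient_classI xf.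
  by rewrite quotient_classU joinx0.
by rewrite -quotient_classU xe quotient_classU (join_r (leIr _ _)).
Qed.

End Distributive.

(** Annihilators are unions of congruence classes, because only [\bot] is congruent to [\bot]. *)
Lemma annihilators_max e :
  annihilators M (principal_ideal e) -> greatest (congruence_class theta e) e.
Proof.
move=> [U _ Ue]; split=> [|x ex]; first exact: equiv_refl.
have : principal_ideal e x; last by rewrite principal_idealE.
have : principal_ideal e e by rewrite principal_idealE /=.
rewrite -Ue => eU u Uu; apply: congruence_eq0; rewrite -(eU u Uu).
apply: congruence_meet; last exact: equiv_refl.
by rewrite equiv_sym.
Qed.

(** An element congruent to [e] has the same complement [f], so uniqueness of the complement of [f]
    makes it equal to [e]. *)
Lemma uniquely_complemented_max : uniquely_complemented M ->
  forall e, complemented M e -> greatest (congruence_class theta e) e.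
Proof.
move=> Muniq e [f ef]; split=> [|x ex]; first exact: equiv_refl.
have xf := complement_congruence ef ex.
have Bf : complemented M f by exists e; exact: is_complement_sym.
have [g [_ fg]] := Muniq f Bf.
by rewrite -(fg e (is_complement_sym ef)) (fg x (is_complement_sym xf)).
Qed.

Lemma boolean_sublattice_max : boolean_sublattice (complemented M) ->
  forall e, complemented M e -> greatest (congruence_class theta e) e.
Proof.
move=> [_ Bdistr _] e [f ef]; split=> [|x ex]; first exact: equiv_refl.
have xf := complement_congruence ef ex.
have Be : complemented M e by exists f.
have Bx : complemented M x by exists f.
have Bf : complemented M f by exists e; exact: is_complement_sym.
apply/meet_idPl; rewrite -[RHS]meetx1 -ef.2 Bdistr // xf.1.
by rewrite joinx0.
Qed.

End Congruence.

(** * Comparison of the conditions across sizes *)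

Theorem theorem4p19 (d : Order.disp_t) (M : tbLatticeType d)
    (theta : congruence M)
    (theta0 : congruence_class theta \bot = [set \bot])
    (theta1 : congruence_class theta \top = [set \top])
    (m : Type) (m_neq0 : [set: m] !=set0) :
  let Q : latticeType d := quotient_lattice theta in
  let max_hyp :=
    forall e : M, complemented M e -> greatest (congruence_class theta e) e in
  [/\ (forall e : M, complemented M e -> annihilators M (principal_ideal e)) ->
        max_hyp,
      uniquely_complemented M -> max_hyp,
      boolean_sublattice (complemented M) -> max_hyp &
      max_hyp ->
      [/\ (* (i) *)
          distributive_lattice Q ->
          forall K : Type, [set: K] !=set0 ->
          forall h i : condition_index,
            condition M h (AtMost K) <-> condition M i (AtMost K),
          (* (ii) *)
          (has_small_joins (AtMost m) Q ->
           meet_distributes_small_joins (AtMost m) Q ->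
           small_annihilators M (AtMost m) = PAnn M) /\
          (distributive_lattice Q ->
           small_annihilators M (AtMost m) = PAnn M ->
           forall (h i : condition_index) (K : Type),
             [set: K] !=set0 -> [set: K] #<= [set: m] ->
             (condition M h (AtMost K) <-> condition M i FinitelyMany)) &
          (* (iii) *)
          (frame Q -> distributive_lattice Q /\ annihilators M = PAnn M) /\
          (distributive_lattice Q ->
           annihilators M = PAnn M ->
           forall (h i j : condition_index) (K : Type),
             [set: K] !=set0 ->
             [<-> annihilator_meet_law M;
                  condition M h (AtMost K);
                  condition M i FinitelyMany;
                  condition M j AnyNumber])]].

Proof.
move=> Q max_hyp; split.
- by move=> H e Be; exact/(annihilators_max theta0)/H.
- exact: uniquely_complemented_max theta0 theta1.
- exact: boolean_sublattice_max theta0 theta1.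
move=> emax; split.
- move=> Qdistr K K0 h i.
  have M0 := distributive_zero theta0 Qdistr.
  have M1 := distributive_one theta1 Qdistr.
  have Mdom := distributive_dominate Qdistr emax.
  have K1 := unital_AtMost K0.
  by rewrite !condition_condition1.
- split; first exact/(small_annihilators_sup theta0)/unital_AtMost.
  move=> Qdistr mP h i K K0 Km.
  have M0 := distributive_zero theta0 Qdistr.
  have M1 := distributive_one theta1 Qdistr.
  have Mdom := distributive_dominate Qdistr emax.
  rewrite condition_FinitelyMany // condition_stone //.
    exact: unital_AtMost.
  rewrite -mP => _ [U UK <-]; exists U => //.
  exact: card_le_trans UK Km.
- split=> [Qframe|Qdistr MP h i j K K0].
    split; first exact: frame_distributive.
    case: Qframe => Qcomplete; apply: small_annihilators_sup => // V _.
    by case: (Qcomplete V).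
  have M0 := distributive_zero theta0 Qdistr.
  have M1 := distributive_one theta1 Qdistr.
  have Mdom := distributive_dominate Qdistr emax.
  (* All four statements are compared with the Stone property, which involves no size. *)
  have Kstone : condition M h (AtMost K) <-> stone M.
    apply: condition_stone => //; first exact: unital_AtMost.
    by rewrite -MP => _ [U _ <-]; exists U.
  have Fstone : condition M i FinitelyMany <-> stone M.
    exact: condition_FinitelyMany.
  have Astone : condition M j AnyNumber <-> stone M.
    by apply: condition_stone => //; rewrite -MP.
  have Lstone := meet_law_stone M0 M1 Mdom MP.
  by tfae => [/Lstone/Kstone|/Kstone/Fstone|/Fstone/Astone|/Astone/Lstone].
Qed.
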